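(* Let $(X,d,\ll,\leq,\tau)$ be a strongly causal and locally causally closed Lorentzian pre-length space with $\tau$ locally finite-valued and locally continuous. Let $\alpha,\beta,\gamma\colon[0,B)\rightarrow X$ be timelike curves with coinciding time orientation (all future directed or all past directed) starting at $x:=\alpha(0)=\beta(0)=\gamma(0)$. Then the upper angles satisfy $$\measuredangle_x(\alpha,\gamma)\leq \measuredangle_x(\alpha,\beta) + \measuredangle_x(\beta,\gamma).$$
   Context: A causal space is a set $X$ with two transitive relations $\ll,\leq$ such that $\leq$ is reflexive and $p\ll q$ implies $p\leq q$. Write $I^+(p)=\{q:p\ll q\}$, $I^-(q)=\{p:p\ll q\}$, $I(p,q)=I^+(p)\cap I^-(q)$. A Lorentzian pre-length space $(X,d,\ll,\leq,\tau)$ is a causal space with a metric $d$ and a map $\tau\colon X\times X\to[0,\infty]$ that is lower semicontinuous with respect to $d$, satisfies $\tau(p,r)\geq\tau(p,q)+\tau(q,r)$ for $p\leq q\leq r$, and $\tau(p,q)>0\Leftrightarrow p\ll q$. $\tau$ is locally finite-valued (locally continuous) if every point has a neighborhood $U$ with $\tau<\infty$ on $U\times U$ ($\tau$ continuous on $U\times U$). $X$ is locally causally closed if every point has a neighborhood $U$ such that $x_n,y_n\in U$, $x_n\leq y_n$, $x_n\to x\in\bar U$, $y_n\to y\in\bar U$ imply $x\leq y$. $X$ is strongly causal if the timelike diamonds $I(p,q)$, $p,q\in X$, form a subbase of the topology induced by $d$. A non-constant locally Lipschitz (with respect to $d$) curve $\gamma\colon I\to X$ is future directed timelike if $\gamma(t_1)\ll\gamma(t_2)$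 for all $t_1<t_2$ in $I$, and past directed timelike if $\gamma(t_2)\ll\gamma(t_1)$ for all $t_1<t_2$. Comparison angle: let $x,y,z\in X$ be pairwise causally related with all time separations between them finite, and let each of $y,z$ be timelike related to $x$ (in either direction). A comparison triangle is a triple $\bar x,\bar y,\bar z$ in the Minkowski plane $\mathbb{R}^2_1$ (signature $(-,+)$), causally related in the same order and with the same time separations. The comparison (hyperbolic) angle is $\tilde\measuredangle_x(y,z):=\operatorname{arcosh}|\langle u,v\rangle|$, where $u,v$ are the unit timelike initial velocities at $\bar x$ of the geodesic segments from $\bar x$ to $\bar y$ and to $\bar z$. Upper angle: for (future or past directed) timelike curves $\alpha,\beta$ with $\alpha(0)=\beta(0)=x$, let $A_0$ be the set of $(s,t)$ with $s,t>0$ such that $\alpha(s)\leq\beta(t)$ or $\beta(t)\leq\alpha(s)$ and the time separations between $x,\alpha(s),\beta(t)$ are finite. Then $\measuredangle_x(\alpha,\beta):=\limsup_{(s,t)\in A_0;\,s,t\searrow0}\tilde\measuredangle_x(\alpha(s),\beta(t))\in[0,\infty]$. *)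

(* Defs.v *)
From HB Require Import structures.
From mathcomp Require Import all_boot all_order all_algebra.
From mathcomp Require Import all_classical all_reals all_analysis.
From mathcomp Require Import ring lra.

Set Implicit Arguments.
Unset Strict Implicit.
Unset Printing Implicit Defensive.

Import Order.TTheory GRing.Theory Num.Theory.
Import numFieldNormedType.Exports.

Local Open Scope classical_set_scope.
Local Open Scope ring_scope.

Record causal_space (X : Type) := CausalSpace {
  chron : X -> X -> Prop;
  causal : X -> X -> Prop;
  chron_trans : forall p q r, chron p q -> chron q r -> chron p r;
  causal_trans : forall p q r, causal p q -> causal q r -> causal p r;
  causal_refl : forall p, causal p p;
  chronW : forall p q, chron p q -> causal p q
}.

Record lorentzian_prelength (R : realType) (X : metricType R) :=
  LorentzianPrelength {
  lpl_causal :> causal_space X;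
  tau : X -> X -> \bar R;
  tau_ge0 : forall p q, (0 <= tau p q)%E;
  tau_lsc : lower_semicontinuous (fun pq : X * X => tau pq.1 pq.2);
  tau_rev_triangle : forall p q r, causal lpl_causal p q ->
    causal lpl_causal q r -> (tau p q + tau q r <= tau p r)%E;
  tau_gt0 : forall p q, (0 < tau p q)%E <-> chron lpl_causal p q
}.

Section Spaces.
Context {R : realType} {X : metricType R} (L : lorentzian_prelength X).

Definition chron_future (p : X) : set X := [set q | chron L p q].
Definition chron_past (q : X) : set X := [set p | chron L p q].
Definition diamond (p q : X) : set X := chron_future p `&` chron_past q.

Definition locally_finite_valued :=
  forall x : X, exists2 U, nbhs x U &
    forall p q, U p -> U q -> (tau L p q < +oo)%E.

Definition locally_continuous :=
  forall x : X, exists2 U, nbhs x U &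
    {within U `*` U, continuous (fun pq : X * X => tau L pq.1 pq.2)}.

Definition locally_causally_closed :=
  forall x : X, exists2 U, nbhs x U &
    forall (u v : nat -> X) (p q : X),
      (forall n, U (u n)) -> (forall n, U (v n)) ->
      (forall n, causal L (u n) (v n)) ->
      u @ \oo --> p -> closure U p ->
      v @ \oo --> q -> closure U q -> causal L p q.

(* [finI_from] includes the empty intersection, that is, the whole space. *)
Definition strongly_causal :=
  basis (finI_from [set: X * X] (fun pq => diamond pq.1 pq.2)).

End Spaces.

Section Curves.
Context {R : realType} {X : metricType R} (L : lorentzian_prelength X).

(* A curve I -> X is a total function R -> X together with the set I;
   only its values on I matter. *)
Definition locally_lipschitz (I : set R) (c : R -> X) :=
  forall t, I t -> exists2 V, nbhs t V & exists C : R,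
    forall s s', V s -> V s' -> I s -> I s' ->
      mdist (c s) (c s') <= C * `|s - s'|.

Definition nonconstant (I : set R) (c : R -> X) :=
  exists s t, [/\ I s, I t & c s <> c t].

Definition future_timelike (I : set R) (c : R -> X) :=
  [/\ nonconstant I c, locally_lipschitz I c &
      forall s t, I s -> I t -> s < t -> chron L (c s) (c t)].

Definition past_timelike (I : set R) (c : R -> X) :=
  [/\ nonconstant I c, locally_lipschitz I c &
      forall s t, I s -> I t -> s < t -> chron L (c t) (c s)].

End Curves.

(* The interval [0, B), with B = +oo allowed. *)
Definition half_open (R : realType) (B : \bar R) : set R :=
  [set t | 0 <= t /\ (t%:E < B)%E].

Section Arcosh.
Context {R : realType}.

Definition arcosh (y : R) : R := ln (y + Num.sqrt (y ^+ 2 - 1)).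

Lemma arcosh_ge0 (y : R) : 1 <= y -> 0 <= arcosh y.
Proof. by move=> y1; rewrite ln_ge0// -[leLHS]addr0 lerD// sqrtr_ge0. Qed.

Lemma cosh_arcosh (y : R) : 1 <= y ->
  (expR (arcosh y) + expR (- arcosh y)) / 2 = y.
Proof.
move=> y1; rewrite expRN /arcosh.
set s := Num.sqrt _.
have s2 : s ^+ 2 = y ^+ 2 - 1 by rewrite sqr_sqrtr// subr_ge0 expr_ge1// ltW//; lra.
have s0 : 0 <= s by exact: sqrtr_ge0.
rewrite lnK ?posrE; last lra.
have ys : y + s != 0 by apply: lt0r_neq0; lra.
have -> : (y + s)^-1 = y - s.
  by apply: (mulfI ys); rewrite divff//; nra.
lra.
Qed.

End Arcosh.

(* The Minkowski plane, signature (-,+): coordinate 0 is time. *)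
Section Minkowski.
Context {R : realType}.
Implicit Types p q u v : 'rV[R]_2.

Definition mink u v : R := - (u 0 0 * v 0 0) + u 0 1 * v 0 1.

Definition mink_causal p q : bool :=
  (mink (q - p) (q - p) <= 0) && (p 0 0 <= q 0 0).

Definition mink_tau p q : R :=
  if mink_causal p q then Num.sqrt (- mink (q - p) (q - p)) else 0.

(* The geodesic from p to q is the affine segment, with initial velocity
   q - p; this is that velocity normalized, for p, q timelike related. *)
Definition unit_velocity p q : 'rV[R]_2 :=
  (Num.sqrt `|mink (q - p) (q - p)|)^-1 *: (q - p).

End Minkowski.

Section Angles.
Context {R : realType} {X : metricType R} (L : lorentzian_prelength X).

(* Only an implication for the causal order: when y <= z are null related and
   tau x y = tau x z, the comparison points of y and z coincide, hence are
   causally related both ways, although z <= y may fail. *)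
Definition comparison_side (p q : X) (p' q' : 'rV[R]_2) :=
  (causal L p q -> mink_causal p' q') /\ tau L p q = (mink_tau p' q')%:E.

Definition comparison_triangle (x y z : X) (x' y' z' : 'rV[R]_2) :=
  [/\ comparison_side x y x' y' /\ comparison_side y x y' x',
      comparison_side x z x' z' /\ comparison_side z x z' x' &
      comparison_side y z y' z' /\ comparison_side z y z' y'].

(* When y and z are timelike related to x and causally related to each other,
   with finite time separations, a comparison triangle exists and, by the
   hyperbolic law of cosines, the value does not depend on its choice. Only
   such triples matter; on others the value is meaningless. *)
Definition comparison_angle (x y z : X) : R :=
  xget 0 [set w | exists x' y' z', comparison_triangle x y z x' y' z' /\
    w = arcosh `|mink (unit_velocity x' y') (unit_velocity x' z')| ].

Definition finite_separations (p q : X) :=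
  (tau L p q < +oo)%E /\ (tau L q p < +oo)%E.

Definition angle_domain (x : X) (a b : R -> X) : set (R * R) :=
  [set st | [/\ 0 < st.1, 0 < st.2,
    causal L (a st.1) (b st.2) \/ causal L (b st.2) (a st.1) &
    [/\ finite_separations x (a st.1), finite_separations x (b st.2) &
        finite_separations (a st.1) (b st.2)] ] ].

(* The limsup depends only on the germs of a and b at 0, so their values
   outside their intervals [0, B) are irrelevant. *)
Definition upper_angle (x : X) (a b : R -> X) : \bar R :=
  limf_esup (fun st : R * R => (comparison_angle x (a st.1) (b st.2))%:E)
    (within (angle_domain x a b) (filter_prod 0^'+ 0^'+)).

End Angles.

(* Main.v *)
Require Import Defs.
From mathcomp Require Import all_boot all_order all_algebra.
From mathcomp Require Import all_classical all_reals all_analysis.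
From mathcomp Require Import ring lra.

Set Implicit Arguments.
Unset Strict Implicit.
Unset Printing Implicit Defensive.

Import Order.TTheory GRing.Theory Num.Theory.
Import numFieldNormedType.Exports.

Local Open Scope classical_set_scope.
Local Open Scope ring_scope.

(** Reversing the time orientation changes no comparison angle, so all curves
    may be taken future directed. Only a neighbourhood [U] of [x] on which
    [tau] is finite and continuous matters.

    Suppose that [y] on [alpha] and [z] on [gamma], close to [x], satisfy
    [y <= z] and have a comparison angle [w > A + B], where [A] and [B] bound
    the angles between [beta] and [alpha], resp. [gamma], near [x]. Write
    [w = v + v'] with [v > A] and [v' > B]. In the Minkowski plane, the ray
    from the vertex at hyperbolic angle [v] from the first side meets the
    segment joining the comparison points of [y] and [z]; call [b] the time
    separation between the vertex and that meeting point
    ([minkowski_hinge_chord]). By continuity [beta] contains a point [q] with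
    [tau x q = b]. As a smaller angle means a larger opposite side, [tau y q]
    is at least, and [tau q z] strictly more than, the part of the Minkowski
    segment on its side of the meeting point. So [tau y q + tau q z > tau y z],
    against the reverse triangle inequality ([hinge_angle_le]).

    What is special to the Lorentzian case is that [q] must be shown to lie
    causally between [y] and [z]. The function [t |-> tau y (beta t)] vanishes
    at [0] and becomes positive, so it takes arbitrarily small positive values;
    where it does, [y] is in the past of [beta t] while the triangle is almost
    null, and the law of cosines with angle at most [A] forces [tau x (beta t)]
    to be at most about [tau x y * exp A]. Since the meeting point is in the
    causal future of the first comparison point, [b] is at least
    [tau x y * exp v], which is larger: thus [y] is in the past of [q]
    ([curve_leaves_point]). The relation to [z] is dual
    ([curve_returns_to_past]). *)

(** * Triangles in the Minkowski plane *)

Section MinkowskiPlane.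
Context {R : realType}.
Implicit Types p q u v : 'rV[R]_2.

Lemma minkC u v : mink u v = mink v u.
Proof. by rewrite /mink (mulrC (u 0 0)) (mulrC (u 0 1)). Qed.

Lemma minkZ (a b : R) u v : mink (a *: u) (b *: v) = a * b * mink u v.
Proof. by rewrite /mink !mxE; ring. Qed.

Lemma minkN u v : mink (- u) (- v) = mink u v.
Proof. by rewrite /mink !mxE; ring. Qed.

Lemma mink_polar u v :
  mink u v *+ 2 = mink u u + mink v v - mink (v - u) (v - u).
Proof. by rewrite /mink !mxE; ring. Qed.

Lemma mink_tau_sqr p q : mink_causal p q ->
  mink (q - p) (q - p) = - mink_tau p q ^+ 2.
Proof.
move=> pq; rewrite /mink_tau pq sqr_sqrtr ?opprK// oppr_ge0.
by case/andP: pq.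
Qed.

Lemma mink_tau_gt0 p q : 0 < mink_tau p q -> mink_causal p q.
Proof. by rewrite /mink_tau; case: ifP => //; rewrite ltxx. Qed.

Lemma mink_causalN p q : mink_causal (- q) (- p) = mink_causal p q.
Proof.
rewrite /mink_causal opprK (addrC (- p)); congr (_ && _).
by rewrite !mxE lerN2.
Qed.

Lemma mink_tauN p q : mink_tau (- q) (- p) = mink_tau p q.
Proof. by rewrite /mink_tau mink_causalN opprK (addrC (- p)). Qed.

Lemma unit_velocityN p q : unit_velocity (- p) (- q) = - unit_velocity p q.
Proof.
by rewrite /unit_velocity -opprD minkN scalerN.
Qed.

(** The hyperbolic law of cosines: the quotient is the hyperbolic cosine of the
    angle, and the sign reflects that two velocities in the same time cone have
    negative inner product in this signature. *)
Lemma mink_law_of_cosines p q r :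
  0 < mink_tau p q -> 0 < mink_tau p r -> mink_causal q r ->
  mink (unit_velocity p q) (unit_velocity p r) =
  - ((mink_tau p q ^+ 2 + mink_tau p r ^+ 2 - mink_tau q r ^+ 2) /
     (2 * mink_tau p q * mink_tau p r)).
Proof.
move=> pq pr qr.
have Epq := mink_tau_sqr (mink_tau_gt0 pq).
have Epr := mink_tau_sqr (mink_tau_gt0 pr).
have Eqr := mink_tau_sqr qr.
have := mink_polar (q - p) (r - p).
have -> : r - p - (q - p) = r - q by rewrite opprB addrA subrK.
rewrite Epq Epr Eqr => E.
rewrite /unit_velocity minkZ Epq Epr !normrN !ger0_norm ?sqr_ge0//.
rewrite !sqrtr_sqr !gtr0_norm//.
have -> : mink (q - p) (r - p) =
  - (mink_tau p q ^+ 2 + mink_tau p r ^+ 2 - mink_tau q r ^+ 2) / 2.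
  move: E; rewrite mulr2n; lra.
by field; rewrite !gt_eqF.
Qed.

Definition event (t s : R) : 'rV[R]_2 :=
  \row_j if j == 0 then t else s.

Lemma event_sub t s t' s' : event t s - event t' s' = event (t - t') (s - s').
Proof. by apply/rowP => j; rewrite !mxE; case: ifP. Qed.

Lemma mink_event t s : mink (event t s) (event t s) = s ^+ 2 - t ^+ 2.
Proof. by rewrite /mink !mxE/=; ring. Qed.

Lemma mink_causal_event t s t' s' :
  mink_causal (event t s) (event t' s') =
  ((s' - s) ^+ 2 <= (t' - t) ^+ 2) && (t <= t').
Proof. by rewrite /mink_causal event_sub mink_event subr_le0 !mxE. Qed.

Lemma mink_tau_event t s t' s' : mink_tau (event t s) (event t' s') =
  if ((s' - s) ^+ 2 <= (t' - t) ^+ 2) && (t <= t')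
  then Num.sqrt ((t' - t) ^+ 2 - (s' - s) ^+ 2) else 0.
Proof.
by rewrite /mink_tau mink_causal_event event_sub mink_event opprB.
Qed.

(** The side [a] is placed on the time axis; the law of cosines then dictates
    the time coordinate of the third vertex. The last conclusion covers causal
    cycles: if [a = b] then [c = 0] and the two far vertices coincide. *)
Lemma minkowski_triangle (a b c : R) : 0 < a -> 0 <= c -> a + c <= b ->
  exists o y z : 'rV[R]_2,
  [/\ mink_tau o y = a /\ mink_tau y o = 0,
      mink_tau o z = b /\ mink_tau z o = 0,
      [/\ mink_causal y z, mink_tau y z = c & mink_tau z y = 0] &
      a = b -> mink_causal z y].
Proof.
move=> a0 c0 acb.
(* The time coordinate [p] of the third vertex is [b] times the hyperbolic cosine
   of the angle. *)
pose p := (a ^+ 2 + b ^+ 2 - c ^+ 2) / (2 * a).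
have pE : 2 * a * p = a ^+ 2 + b ^+ 2 - c ^+ 2.
  by rewrite /p; field; rewrite gt_eqF.
have bp : b <= p.
  have : 0 <= (b - a - c) * (b - a + c) by apply: mulr_ge0; lra.
  have -> : (b - a - c) * (b - a + c) = (2 * a) * (p - b).
    by rewrite mulrBr pE; ring.
  by rewrite pmulr_rge0 ?subr_ge0//; lra.
have pb : 0 <= p ^+ 2 - b ^+ 2.
  by rewrite subr_sqr mulr_ge0//; lra.
pose q := Num.sqrt (p ^+ 2 - b ^+ 2).
have qE : q ^+ 2 = p ^+ 2 - b ^+ 2 by rewrite sqr_sqrtr.
have cE : (p - a) ^+ 2 - q ^+ 2 = c ^+ 2 by rewrite qE; lra.
exists (event 0 0), (event a 0), (event p q).
split.
- rewrite !mink_tau_event !subr0 !sub0r (ltW a0) expr0n/= sqr_ge0/= subr0 sqrtr_sqr.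
  by rewrite gtr0_norm// (lt_geF a0) andbF.
- rewrite !mink_tau_event !subr0 !sub0r.
  have -> : 0 <= p by lra.
  have -> : (p <= 0) = false by lra.
  rewrite andbF andbT qE subKr sqrtr_sqr ger0_norm; last lra.
  by rewrite lerBlDr lerDl sqr_ge0.
- have ap : a <= p by lra.
  rewrite !mink_tau_event mink_causal_event subr0 sub0r sqrrN -(sqrrN (a - p)).
  rewrite opprB cE -subr_ge0 cE sqr_ge0 ap/= sqrtr_sqr ger0_norm//; split => //.
  case: ifP => // pa; have {}pa : p = a by lra.
  suff -> : c = 0 by [].
  have : c ^+ 2 <= 0 by rewrite -cE pa subrr expr0n sub0r oppr_le0 sqr_ge0.
  nra.
- move=> ab; have c00 : c = 0 by lra.
  have pa : p = a.
    apply: (@mulfI _ (2 * a)); first by rewrite gt_eqF//; lra.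
    by rewrite pE c00 -ab; ring.
  by rewrite mink_causal_event sub0r sqrrN qE pa ab !subrr expr0n/= !lexx.
Qed.

End MinkowskiPlane.

(** * Hyperbolic cosines and the subdivided hinge *)

Lemma expR_mulN (R : realType) (v : R) : expR v * expR (- v) = 1.
Proof. by rewrite -expRD subrr expR0. Qed.

Lemma ltr_expRDN (R : realType) (v w : R) : 0 <= v -> v < w ->
  expR v + expR (- v) < expR w + expR (- w).
Proof.
move=> v0 vw; have V1 : 1 <= expR v by rewrite -expR0 ler_expR.
have VW : expR v < expR w by rewrite ltr_expR.
have Vi : expR v * expR (- v) = 1 by exact: expR_mulN.
have Wi : expR w * expR (- w) = 1 by exact: expR_mulN.
have Wn0 : expR (- w) < 1 by rewrite -expR0 ltr_expR; lra.
move: V1 VW Vi Wi Wn0; set V := expR v; set V' := expR (- v).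
set W := expR w; set W' := expR (- w) => V1 VW Vi Wi Wn0.
have -> : V + V' = W + W' - (W - V) * (1 - V' * W').
  rewrite mulrBr mulr1 mulrBl (mulrC V' W') mulrA Wi mul1r.
  by rewrite (mulrC W') mulrA Vi mul1r; ring.
have W'0 : 0 <= W' by rewrite expR_ge0.
have V'0 : 0 <= V' by rewrite expR_ge0.
have V'1 : V' <= 1 by nra.
have : 0 < (W - V) * (1 - V' * W') by apply: mulr_gt0; nra.
lra.
Qed.

Lemma ler_expRDN (R : realType) (v w : R) : 0 <= v -> v <= w ->
  expR v + expR (- v) <= expR w + expR (- w).
Proof.
by move=> v0; rewrite le_eqVlt => /predU1P[->//|vw]; exact/ltW/ltr_expRDN.
Qed.

(** The law of cosines in null coordinates, for [k] the exponential of the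
    rapidity. *)
Lemma cosine_law_factor (R : comRingType) (p q k k' : R) : k * k' = 1 ->
  p ^+ 2 + q ^+ 2 - p * q * (k + k') = (q * k - p) * (q * k' - p).
Proof.
move=> kk'; have -> : q ^+ 2 = q ^+ 2 * (k * k') by rewrite kk' mulr1.
ring.
Qed.

(** Null coordinates make this elementary: place the first point at [(a, a)] and
    the last at [(c * exp (v + w), c * exp (- (v + w)))], the metric being the
    product of coordinates. The ray of rapidity [v] meets the chord between
    them at [(b * exp v, b * exp (- v))], and [l] is the fraction of the chord
    cut off. The two inequalities say that the meeting point is in the causal
    future of the first point and in the causal past of the last. *)
Lemma minkowski_hinge_chord (R : realType) (a c d v w : R) :
  0 < a -> a <= c -> 0 < v -> 0 < w ->
  d ^+ 2 = a ^+ 2 + c ^+ 2 - a * c * (expR (v + w) + expR (- (v + w))) ->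
  exists b l, [/\ a * expR v <= b, b * expR w <= c, 0 <= l <= 1,
   (l * d) ^+ 2 = a ^+ 2 + b ^+ 2 - a * b * (expR v + expR (- v)) &
   ((1 - l) * d) ^+ 2 = b ^+ 2 + c ^+ 2 - b * c * (expR w + expR (- w))].
Proof.
move=> a0 ac v0 w0; rewrite opprD !expRD.
have V1 : 1 < expR v by rewrite -expR0 ltr_expR.
have W1 : 1 < expR w by rewrite -expR0 ltr_expR.
have V'0 : 0 < expR (- v) by rewrite expR_gt0.
have W'0 : 0 < expR (- w) by rewrite expR_gt0.
move: V1 W1 (expR_mulN v) (expR_mulN w) V'0 W'0.
set V := expR v; set V' := expR (- v).
set W := expR w; set W' := expR (- w) => V1 W1 Vi Wi V'0 W'0.
have V'1 : V' < 1 by nra.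
have W'1 : W' < 1 by nra.
have VW1 : 1 < V * W by nra.
rewrite cosine_law_factor; last by rewrite mulrACA Vi Wi mulr1.
move=> d2.
have acVW : 0 <= c * (V' * W') - a.
  have : 0 <= (c * (V * W) - a) * (c * (V' * W') - a) by rewrite -d2 sqr_ge0.
  by rewrite pmulr_rge0// subr_gt0; nra.
pose D := a * (V - V') + c * (W - W').
have D1 : 0 < a * (V - V') by rewrite mulr_gt0//; lra.
have D2 : 0 < c * (W - W') by rewrite mulr_gt0//; lra.
have D0 : 0 < D by rewrite addr_gt0.
(* [D] is twice [a * sinh v + c * sinh w]; [l] and [b] solve the linear system
   [bV], [bV'] below, which puts the point on the chord. *)
pose l := a * (V - V') / D.
pose b := a * c * (V * W - V' * W') / D.
have lD : l * D = a * (V - V') by rewrite divfK// gt_eqF.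
have bD : b * D = a * c * (V * W - V' * W') by rewrite divfK// gt_eqF.
have l0 : 0 <= l by rewrite divr_ge0// ltW.
have l1 : l <= 1 by rewrite ler_pdivrMr// mul1r /D; lra.
have bV : b * V - a = l * (c * (V * W) - a).
  apply: (@mulIf _ D); first by rewrite gt_eqF.
  rewrite mulrBl (mulrAC b) bD (mulrAC l) lD /D.
  have -> : a * c * (V * W - V' * W') * V = a * c * (V * V * W - W' * (V * V')).
    by ring.
  have -> : a * (V - V') * (c * (V * W) - a) =
     a * (c * (V * V * W - W * (V * V')) - (V - V') * a) by ring.
  by rewrite Vi; ring.
have bV' : b * V' - a = l * (c * (V' * W') - a).
  apply: (@mulIf _ D); first by rewrite gt_eqF.
  rewrite mulrBl (mulrAC b) bD (mulrAC l) lD /D.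
  have -> : a * c * (V * W - V' * W') * V' =
    a * c * (W * (V * V') - V' * V' * W') by ring.
  have -> : a * (V - V') * (c * (V' * W') - a) =
     a * (c * (W' * (V * V') - V' * V' * W') - (V - V') * a) by ring.
  by rewrite Vi; ring.
have cb : c * (V * W) - b * V = (1 - l) * (c * (V * W) - a) by lra.
have cb' : c * (V' * W') - b * V' = (1 - l) * (c * (V' * W') - a) by lra.
exists b, l; split.
- have : 0 <= V * (b * V' - a).
    by rewrite bV'; apply: mulr_ge0; [lra|exact: mulr_ge0].
  have -> : V * (b * V' - a) = b * (V * V') - a * V by ring.
  by rewrite Vi; lra.
- have : 0 <= V * W * (c * (V' * W') - b * V').
    by rewrite cb'; apply: mulr_ge0; [lra|apply: mulr_ge0 => //; lra].
  have -> : V * W * (c * (V' * W') - b * V') =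
    (V * V') * (c * (W * W') - b * W) by ring.
  by rewrite Vi Wi; lra.
- by rewrite l0.
- by rewrite cosine_law_factor// bV bV' mulrACA -expr2 -d2 exprMn.
- rewrite cosine_law_factor//; have -> : (c * W - b) * (c * W' - b) =
    (c * W - b) * (c * W' - b) * (V * V') by rewrite Vi mulr1.
  have -> : (c * W - b) * (c * W' - b) * (V * V') =
    (c * (V * W) - b * V) * (c * (V' * W') - b * V') by ring.
  by rewrite cb cb' mulrACA -expr2 -d2 exprMn.
Qed.

(** * The law of cosines for comparison angles *)

Section Comparison.
Context {R : realType} {X : metricType R} (L : lorentzian_prelength X).
Implicit Types x y z p q : X.

Local Notation tr p q := (fine (tau L p q)).

Lemma comparison_angleC x y z :
  comparison_angle L x y z = comparison_angle L x z y.
Proof.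
congr (xget 0 _); apply/seteqP.
by split=> w [x' [y' [z' [[xy xz [yz zy]] ->]]]];
  exists x', z', y'; split; rewrite 1?minkC; split.
Qed.

(** In [tau p p + tau p q <= tau p q] the finite term [tau p q] cancels. *)
Lemma tau_self_eq0l p q : causal L p q -> (tau L p q < +oo)%E ->
  tau L p p = 0%E.
Proof.
move=> pq pqoo; have := tau_rev_triangle (causal_refl L p) pq.
have := tau_ge0 L p q; have := tau_ge0 L p p.
case: (tau L p p) (tau L p q) pqoo => [a| |] [b| |] //= _.
by rewrite -EFinD !lee_fin => *; congr EFin; lra.
Qed.

Lemma tau_self_eq0r p q : causal L p q -> (tau L p q < +oo)%E ->
  tau L q q = 0%E.
Proof.
move=> pq pqoo; have := tau_rev_triangle pq (causal_refl L q).
have := tau_ge0 L p q; have := tau_ge0 L q q.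
case: (tau L q q) (tau L p q) pqoo => [a| |] [b| |] //= _.
by rewrite -EFinD !lee_fin => *; congr EFin; lra.
Qed.

Lemma tau_loop_eq0 p q : causal L p q -> causal L q p ->
  tau L p p = 0%E -> tau L p q = 0%E /\ tau L q p = 0%E.
Proof.
move=> pq qp pp; have := tau_rev_triangle pq qp; rewrite pp.
have := tau_ge0 L p q; have := tau_ge0 L q p.
case: (tau L q p) (tau L p q) => [a| |] [b| |] //=.
by rewrite -EFinD !lee_fin => *; split; congr EFin; lra.
Qed.

Lemma tau_causal0 p q : ~ causal L p q -> tau L p q = 0%E.
Proof.
move=> pq; apply/eqP; rewrite eq_le tau_ge0 andbT leNgt.
by apply/negP => tpq; apply: pq; apply: chronW; exact/tau_gt0.
Qed.

Lemma tr_rev_triangle p q r : causal L p q -> causal L q r ->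
  (tau L p r < +oo)%E -> tr p q + tr q r <= tr p r.
Proof.
move=> pq qr pr; have := tau_rev_triangle pq qr.
have := tau_ge0 L p q; have := tau_ge0 L q r; have := tau_ge0 L p r.
by case: (tau L p q) (tau L q r) (tau L p r) pr => [a| |] [b| |] [c| |].
Qed.

Lemma fin_tau_sub p q r : causal L p q -> causal L q r ->
  (tau L p r < +oo)%E -> tau L p q = (tr p q)%:E /\ tau L q r = (tr q r)%:E.
Proof.
move=> pq qr pr; have := tau_rev_triangle pq qr.
have := tau_ge0 L p q; have := tau_ge0 L q r.
by case: (tau L p q) (tau L q r) (tau L p r) pr => [a| |] [b| |] [c| |].
Qed.

(** Any comparison triangle satisfies the law of cosines, and the reverse
    triangle inequality guarantees that one exists; hence the law determines
    the comparison angle. Finiteness of [tau x z] excludes causal cycles through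
    [x], so the comparison points of [y] and [z] lie properly to the future. *)
Lemma comparison_law_of_cosines x y z (th := comparison_angle L x y z) :
  chron L x y -> chron L x z -> causal L y z -> (tau L x z < +oo)%E ->
  0 <= th /\ tr y z ^+ 2 =
    tr x y ^+ 2 + tr x z ^+ 2 - tr x y * tr x z * (expR th + expR (- th)).
Proof.
move=> xy xz yz xzoo.
have xzE : tau L x z = (tr x z)%:E by rewrite fineK// ge0_fin_numE// tau_ge0.
have [xyE yzE] := fin_tau_sub (chronW xy) yz xzoo.
have ltri := tr_rev_triangle (chronW xy) yz xzoo.
have a0 : 0 < tr x y by rewrite -lte_fin -xyE; apply/tau_gt0.
have c0 : 0 <= tr y z by rewrite fine_ge0// tau_ge0.
have noyx : ~ causal L y x.
  move=> yx.
  have xx := tau_self_eq0l (chronW xz) xzoo.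
  have [E _] := tau_loop_eq0 (chronW xy) yx xx.
  by move: a0; rewrite E ltxx.
have nozx : ~ causal L z x by move=> zx; apply: noyx; exact: causal_trans zx.
set a := tr x y in a0 ltri *; set b := tr x z in ltri *.
set c := tr y z in c0 ltri *.
have b0 : 0 < b by lra.
pose C := (a ^+ 2 + b ^+ 2 - c ^+ 2) / (2 * a * b).
have ab0 : 0 < 2 * a * b by rewrite !mulr_gt0.
have C1 : 1 <= C.
  rewrite /C ler_pdivlMr// mul1r.
  have : 0 <= (b - a - c) * (b - a + c) by apply: mulr_ge0; lra.
  nra.
suff thE : th = arcosh C.
  rewrite thE arcosh_ge0//; split => //.
  have := cosh_arcosh C1; set e := expR _ + _ => He.
  have -> : e = C * 2 by lra.
  by rewrite /C; field; rewrite !gt_eqF.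
rewrite /th /comparison_angle; case: xgetP => [_ ->|].
  case=> x' [y' [z' [[[[_ xy'] _] [[_ xz'] _] [[/(_ yz) yz' yzt] _]] ->]]].
  move: xy' xz' yzt; rewrite xyE xzE yzE => -[xy'] [xz'] [yzt].
  rewrite mink_law_of_cosines -?xy' -?xz' -?yzt// normrN ger0_norm//.
  exact: le_trans C1.
have [w [y' [z' [[wy yw] [wz zw] [yz' yzt zy] abzy]]]] :=
  minkowski_triangle a0 c0 ltri.
move/(_ (arcosh `|mink (unit_velocity w y') (unit_velocity w z')|)).
case; exists w, y', z'; split => //; split; split; split => //.
- by rewrite mink_tau_gt0// wy.
- by rewrite wy.
- by rewrite yw tau_causal0.
- by rewrite mink_tau_gt0// wz.
- by rewrite wz.
- by rewrite zw tau_causal0.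
- by rewrite yzt.
- move=> czy; apply: abzy.
  have xyoo : (tau L x y < +oo)%E by rewrite xyE ltey.
  have bca : b + tr z y <= a := tr_rev_triangle (chronW xz) czy xyoo.
  have zy0 : 0 <= tr z y := fine_ge0 (tau_ge0 L z y).
  lra.
- rewrite zy; case: (pselect (causal L z y)) => [czy|/tau_causal0//].
  have yy := tau_self_eq0r (chronW xy) _.
  by apply: (tau_loop_eq0 yz czy (yy _)).2; rewrite xyE ltey.
Qed.

End Comparison.

(** * Comparing a hinge with an intermediate curve *)

Section Hinge.
Context {R : realType} {X : metricType R} (L : lorentzian_prelength X).
Variable U : set X.
Hypothesis Ufin : forall p q, U p -> U q -> (tau L p q < +oo)%E.
Hypothesis Ucont :
  {within U `*` U, continuous (fun pq : X * X => tau L pq.1 pq.2)}.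

Local Notation tr p q := (fine (tau L p q)).

(** What remains of a future directed timelike curve starting at [x] once it is
    cut at a parameter [e] so small that it stays in [U]. *)
Definition timelike_germ x e (a : R -> X) :=
  [/\ a 0 = x, {within `[0, e], continuous a},
      forall t, 0 <= t <= e -> U (a t) &
      forall s t, 0 <= s -> s < t -> t <= e -> chron L (a s) (a t)].

Lemma tau_continuous (I : set R) (f g : R -> X) :
  {within I, continuous f} -> {within I, continuous g} ->
  (forall t, I t -> U (f t)) -> (forall t, I t -> U (g t)) ->
  {within I, continuous (fun t => tr (f t) (g t))}.
Proof.
move=> /subspace_continuousP cf /subspace_continuousP cg Uf Ug.
apply/subspace_continuousP => t It; apply: fine_cvg.
rewrite fineK; last by rewrite ge0_fin_numE ?tau_ge0// Ufin//; auto.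
have /subspace_continuousP/(_ (f t, g t)) := Ucont.
move=> /(_ (conj (Uf _ It) (Ug _ It))) ct.
apply: (@cvg_comp _ _ _ (fun s => (f s, g s)) _ _ _ _ _ ct) => A.
move=> nA.
have H : \forall s \near within I (nbhs t),
  (U `*` U) (f s, g s) -> A (f s, g s).
  exact: (cvg_pair (cf _ It) (cg _ It) nA).
change (within I (nbhs t) (fun s => A (f s, g s))).
have := @filterS2 _ (within I (nbhs t)) _ _ _ _ _ H (withinT I _).
apply => s fgA Is.
by apply: fgA; split => /=; auto.
Qed.

Lemma tr_gt0 p q : U p -> U q -> chron L p q <-> 0 < tr p q.
Proof.
move=> Up Uq; rewrite -lte_fin fineK ?ge0_fin_numE ?tau_ge0 ?Ufin//.
by split => ?; exact/tau_gt0.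
Qed.

Lemma tr_ge0 p q : 0 <= tr p q.
Proof. by rewrite fine_ge0// tau_ge0. Qed.

Lemma tr_self p : U p -> tr p p = 0.
Proof. by move=> Up; rewrite (tau_self_eq0l (causal_refl L p))// Ufin. Qed.

Lemma chron_asym p q : U p -> chron L p q -> ~ chron L q p.
Proof.
move=> Up pq qp; have := (tr_gt0 Up Up).1 (chron_trans pq qp).
by rewrite tr_self// ltxx.
Qed.

Lemma tau_ivt e (f g : R -> X) v : 0 <= e ->
  {within `[0, e], continuous f} -> {within `[0, e], continuous g} ->
  (forall t, 0 <= t <= e -> U (f t)) -> (forall t, 0 <= t <= e -> U (g t)) ->
  Num.min (tr (f 0) (g 0)) (tr (f e) (g e)) <= v
    <= Num.max (tr (f 0) (g 0)) (tr (f e) (g e)) ->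
  exists2 t, 0 <= t <= e & tr (f t) (g t) = v.
Proof.
move=> e0 cf cg Uf Ug H.
have I0 t : [set` `[0, e]] t -> 0 <= t <= e by rewrite /= in_itv.
have [t + <-] := IVT e0 (tau_continuous cf cg
  (fun t It => Uf t (I0 t It)) (fun t It => Ug t (I0 t It))) H.
by rewrite in_itv => te; exists t.
Qed.

Section Beta.
Variables (x : X) (e : R) (beta : R -> X).
Hypothesis e0 : 0 < e.
Hypothesis Hbeta : timelike_germ x e beta.

Let betax : beta 0 = x. Proof. by case: Hbeta. Qed.
Let betac : {within `[0, e], continuous beta}. Proof. by case: Hbeta. Qed.
Let Ubeta t : 0 <= t <= e -> U (beta t). Proof. by case: Hbeta => _ _ + _; apply. Qed.
Let betal s t : 0 <= s -> s < t -> t <= e -> chron L (beta s) (beta t).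
Proof. by case: Hbeta => _ _ _; apply. Qed.
Let Ux : U x. Proof. by rewrite -betax; apply: Ubeta; rewrite lexx ltW. Qed.
Let cstc (p : X) : {within `[0, e], continuous (fun=> p)}.
Proof. by apply: continuous_subspaceT => ?; exact: cst_continuous. Qed.

Lemma tr_curve_mono s t : 0 <= s -> s <= t -> t <= e ->
  tr x (beta s) <= tr x (beta t).
Proof.
move=> s0; rewrite le_eqVlt => /predU1P[->//|st] te.
have xs : causal L x (beta s).
  rewrite -betax; move: s0; rewrite le_eqVlt => /predU1P[<-|s0].
    exact: causal_refl.
  by apply/chronW/betal => //; lra.
have Ut : U (beta t) by apply: Ubeta; lra.
have := tr_rev_triangle xs (chronW (betal s0 st te)) (Ufin Ux Ut).
have := tr_ge0 (beta s) (beta t); lra.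
Qed.

(** Where [tau y (beta t)] is a small positive number [v], the law of cosines
    bounds [(tau x (beta t) - a * exp A) * (tau x (beta t) - a * exp (- A))] by
    [v ^+ 2], [a] being [tau x y]; this product is large when
    [tau x (beta t) >= b]. *)
Lemma curve_leaves_point y A b : U y -> chron L x y -> chron L y (beta e) ->
  0 <= A -> (forall t, 0 < t <= e -> causal L y (beta t) ->
    comparison_angle L x y (beta t) <= A) ->
  tr x y * expR A < b ->
  exists t, [/\ 0 < t <= e, chron L y (beta t) & tr x (beta t) < b].
Proof.
move=> Uy xy ye A0 HA yb.
have a0 := (tr_gt0 Ux Uy).1 xy.
set a := tr x y in a0 yb *.
have eA : expR (- A) <= expR A by rewrite ler_expR; lra.
have eA0 := expR_gt0 A; have eA'0 := expR_gt0 (- A).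
pose m := (b - a * expR A) * (b - a * expR (- A)).
have m0 : 0 < m by rewrite mulr_gt0//; nra.
have g0 := (tr_gt0 Uy (Ubeta _)).1 ye.
have {}g0 : 0 < tr y (beta e) by apply: g0; rewrite lexx ltW.
(* [v] has to be a value of [tau y (beta t)] with [v ^+ 2 < m]; as [v < 1], it is
   enough that [v <= m / 2]. *)
pose v := Num.min (tr y (beta e)) (Num.min 1 m / 2).
have v0 : 0 < v by rewrite lt_min g0 divr_gt0// lt_min ltr01 m0.
have vm : v ^+ 2 < m.
  have v1 : v <= 1 / 2 by rewrite /v !ge_min ler_pM2r// ge_min lexx orbT.
  have : v <= m / 2 by rewrite /v !ge_min ler_pM2r// ge_min lexx !orbT.
  nra.
have gx : tr y (beta 0) = 0.
  rewrite betax; apply/eqP; rewrite eq_le tr_ge0 andbT leNgt; apply/negP.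
  by move/(tr_gt0 Uy Ux); exact: chron_asym.
have [||||||t te tv] := @tau_ivt e (fun=> y) beta v => //.
- exact: ltW.
- by rewrite gx min_l ?max_r ?tr_ge0// (ltW v0)/= /v ge_min lexx.
have ybt : chron L y (beta t) by apply/(tr_gt0 Uy (Ubeta te)); rewrite tv.
have t0 : 0 < t.
  rewrite lt_neqAle; have /andP[-> _] := te; rewrite andbT.
  by apply/eqP => t0; move: tv; rewrite -t0 gx => v00; rewrite -v00 ltxx in v0.
have te' : 0 < t <= e by rewrite t0; case/andP: te.
exists t; split => //.
have [|th0] := @comparison_law_of_cosines _ _ L x y (beta t) xy _ (chronW ybt) (Ufin Ux (Ubeta te)).
  exact: chron_trans ybt.
rewrite tv -/a => E; rewrite ltNge; apply/negP => bt.
have thA := HA _ te' (chronW ybt).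
have cA := ler_expRDN th0 thA.
have : m <= v ^+ 2; last lra.
set bt' := tr x (beta t) in bt E *.
have : a ^+ 2 + bt' ^+ 2 - a * bt' * (expR A + expR (- A)) <= v ^+ 2.
  by rewrite E lerD2l lerN2 ler_pM2l// mulr_gt0//; nra.
have -> : a ^+ 2 + bt' ^+ 2 - a * bt' * (expR A + expR (- A)) =
  (bt' - a * expR A) * (bt' - a * expR (- A)).
  rewrite -[RHS]mulrNN !opprB -cosine_law_factor ?expR_mulN//; ring.
apply: le_trans; apply: ler_pM; nra.
Qed.

(** Time dual of [curve_leaves_point]: the curve leaves the past of [z] only
    after [tau x (beta t)] has come close to [tau x z * exp (- A)]. *)
Lemma curve_returns_to_past z A b : U z -> chron L x z -> chron L z (beta e) ->
  0 <= A -> (forall t, 0 < t <= e -> causal L (beta t) z ->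
    comparison_angle L x (beta t) z <= A) ->
  0 < b -> b * expR A < tr x z ->
  exists t, [/\ 0 < t <= e, chron L (beta t) z & b < tr x (beta t)].
Proof.
move=> Uz xz ze A0 HA b0 zb.
have c0 := (tr_gt0 Ux Uz).1 xz.
set c := tr x z in c0 zb *.
have eA : expR (- A) <= expR A by rewrite ler_expR; lra.
have eA0 := expR_gt0 A; have eA'0 := expR_gt0 (- A).
pose m := (c - b * expR A) * (c - b * expR (- A)).
have m0 : 0 < m by rewrite mulr_gt0//; nra.
pose v := Num.min c (Num.min 1 m / 2).
have v0 : 0 < v by rewrite lt_min c0 divr_gt0// lt_min ltr01 m0.
have vm : v ^+ 2 < m.
  have v1 : v <= 1 / 2 by rewrite /v !ge_min ler_pM2r// ge_min lexx orbT.
  have : v <= m / 2 by rewrite /v !ge_min ler_pM2r// ge_min lexx !orbT.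
  nra.
have Ue : U (beta e) by apply: Ubeta; rewrite lexx ltW.
have ge0 : tr (beta e) z = 0.
  apply/eqP; rewrite eq_le tr_ge0 andbT leNgt; apply/negP.
  by move/(tr_gt0 Ue Uz); exact: chron_asym.
have [||||||t te tv] := @tau_ivt e beta (fun=> z) v => //.
- exact: ltW.
- by rewrite ge0 betax min_r ?max_l ?tr_ge0// (ltW v0)/= /v ge_min lexx.
have tz : chron L (beta t) z by apply/(tr_gt0 (Ubeta te) Uz); rewrite tv.
have [t0 te'] : 0 <= t /\ t <= e by apply/andP.
(* At parameter [0] the value would be [c], but [v ^+ 2 < m < c ^+ 2]. *)
have {}t0 : 0 < t.
  rewrite lt_neqAle t0 andbT; apply/eqP => t0'.
  have cv : c = v by rewrite -tv -t0' betax.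
  suff : m < c * c by move: vm; rewrite -cv expr2; lra.
  have bK : b * expR (- A) <= b * expR A by rewrite ler_pM2l.
  have bK0 : 0 < b * expR (- A) by rewrite mulr_gt0.
  by apply: ltr_pM; lra.
have {}te' : 0 < t <= e by rewrite t0.
have xt : chron L x (beta t).
  by rewrite -betax; apply: betal => //; case/andP: te'.
exists t; split => //.
have [th0] := comparison_law_of_cosines xt xz (chronW tz) (Ufin Ux Uz).
rewrite tv -/c => E; rewrite ltNge; apply/negP => bt.
have thA := HA _ te' (chronW tz).
have cA := ler_expRDN th0 thA.
have bt0 := (tr_gt0 Ux (Ubeta te)).1 xt.
have : m <= v ^+ 2; last lra.
set b' := tr x (beta t) in bt bt0 E *.
have : b' ^+ 2 + c ^+ 2 - b' * c * (expR A + expR (- A)) <= v ^+ 2.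
  by rewrite E lerD2l lerN2 ler_pM2l// mulr_gt0.
have -> : b' ^+ 2 + c ^+ 2 - b' * c * (expR A + expR (- A)) =
  (c - b' * expR A) * (c - b' * expR (- A)).
  rewrite -[RHS]mulrNN !opprB -cosine_law_factor ?expR_mulN//; ring.
apply: le_trans; apply: ler_pM; nra.
Qed.

(** The triangle inequality for a single hinge. If the angle exceeded [A + B],
    the excess could be shared between the two parts; the point of [beta] as far
    from [x] as the meeting point of [minkowski_hinge_chord] would then violate
    the reverse triangle inequality. *)
Lemma hinge_angle_le y z A B : U y -> U z ->
  chron L x y -> chron L x z -> causal L y z ->
  chron L y (beta e) -> chron L z (beta e) -> 0 <= A -> 0 <= B ->
  (forall t, 0 < t <= e -> causal L y (beta t) ->
    comparison_angle L x y (beta t) <= A) ->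
  (forall t, 0 < t <= e -> causal L (beta t) z ->
    comparison_angle L x (beta t) z <= B) ->
  comparison_angle L x y z <= A + B.
Proof.
move=> Uy Uz xy xz yz ye ze A0 B0 HA HB; rewrite leNgt; apply/negP => wAB.
have [_] := comparison_law_of_cosines xy xz yz (Ufin Ux Uz).
set w := comparison_angle L x y z in wAB *.
(* Half of the excess makes both partial angles strictly too large. *)
pose r := (w - A - B) / 2.
have r0 : 0 < r by rewrite divr_gt0//; lra.
have -> : w = (A + r) + (B + r) by rewrite /r; lra.
have a0 := (tr_gt0 Ux Uy).1 xy; have c0 := (tr_gt0 Ux Uz).1 xz.
have d0 := tr_ge0 y z.
have adc := tr_rev_triangle (chronW xy) yz (Ufin Ux Uz).
move=> d2; have [||||b [l [ab bc /andP[l0 l1] lE lE']]] := minkowski_hinge_chord _ _ _ _ d2.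
- exact: a0.
- lra.
- lra.
- lra.
have b0 : 0 < b by apply: lt_le_trans ab; rewrite mulr_gt0// expR_gt0.
have [t1 [t1e yt1 t1b]] : exists t,
    [/\ 0 < t <= e, chron L y (beta t) & tr x (beta t) < b].
  apply: (@curve_leaves_point y A) => //; apply: lt_le_trans ab.
  by rewrite ltr_pM2l// ltr_expR; lra.
have [t2 [t2e t2z bt2]] : exists t,
    [/\ 0 < t <= e, chron L (beta t) z & b < tr x (beta t)].
  apply: (@curve_returns_to_past z B) => //; apply: lt_le_trans bc.
  by rewrite ltr_pM2l// ltr_expR; lra.
have [t10 t1E] := andP t1e; have [t20 t2E] := andP t2e.
have [||||||t te tb] := @tau_ivt e (fun=> x) beta b => //.
- exact: ltW.
- have bte : b <= tr x (beta e).
    by apply: le_trans (ltW bt2) _; apply: tr_curve_mono => //; exact: ltW.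
  have -> : tr x (beta 0) = 0 by rewrite betax tr_self.
  by rewrite min_l ?max_r ?tr_ge0// (ltW b0).
rewrite /= in tb.
have [t0 tE] := andP te.
have lt_param s s' : 0 <= s <= e -> 0 <= s' <= e ->
    tr x (beta s) < tr x (beta s') -> s < s'.
  move=> /andP[s0 sE] /andP[s'0 s'E]; apply: contraTT; rewrite -!leNgt => s's.
  exact: tr_curve_mono.
have t1t : t1 < t by apply: lt_param; rewrite ?tb// ltW.
have tt2 : t < t2 by apply: lt_param; rewrite ?tb// ltW.
have {}t0 : 0 < t by apply: lt_trans t1t.
have yt : chron L y (beta t).
  by apply: chron_trans yt1 _; apply: betal => //; exact: ltW.
have tz : chron L (beta t) z.
  by apply: chron_trans t2z; apply: betal => //; exact: ltW.
have xt : chron L x (beta t) by rewrite -betax; exact: betal.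
have Ut := Ubeta te.
have {te}te : 0 < t <= e by rewrite t0.
have [th0] := comparison_law_of_cosines xy xt (chronW yt) (Ufin Ux Ut).
have [th0'] := comparison_law_of_cosines xt xz (chronW tz) (Ufin Ux Uz).
rewrite tb => E2 E1.
have thA := HA _ te (chronW yt); have thB := HB _ te (chronW tz).
have d1 : l * tr y z <= tr y (beta t).
  rewrite -ler_sqr ?nnegrE ?mulr_ge0 ?tr_ge0// lE E1 lerD2l lerN2.
  by rewrite ler_pM2l ?mulr_gt0//; apply: ler_expRDN => //; lra.
have d2' : (1 - l) * tr y z < tr (beta t) z.
  rewrite -ltr_sqr ?nnegrE ?mulr_ge0 ?tr_ge0 ?subr_ge0//.
  rewrite lE' E2 ltrD2l ltrN2.
  by rewrite ltr_pM2l ?mulr_gt0//; apply: ltr_expRDN => //; lra.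
have := tr_rev_triangle (chronW yt) (chronW tz) (Ufin Uy Uz).
lra.
Qed.

End Beta.
End Hinge.

(** * Upper angles as eventual bounds *)

Section UpperAngle.
Context {R : realType} {X : metricType R} (L : lorentzian_prelength X).

Definition angle_bounded (x : X) (a b : R -> X) (e K : R) :=
  forall s t, 0 < s < e -> 0 < t < e -> angle_domain L x a b (s, t) ->
    comparison_angle L x (a s) (b t) <= K.

Lemma upper_angle_le x a b e K : 0 < e -> angle_bounded x a b e K ->
  (upper_angle L x a b <= K%:E)%E.
Proof.
move=> e0 H; apply: ge_ereal_inf => /=.
pose V := [set st : R * R | angle_domain L x a b st /\ st.1 < e /\ st.2 < e].
exists (ereal_sup ((fun st : R * R =>
  (comparison_angle L x (a st.1) (b st.2))%:E) @` V)); last first.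
  apply: ge_ereal_sup => _ [[s t] /= [D [se te]] <-]; rewrite lee_fin.
  by have [/= s0 t0 _ _] := D; apply: H; rewrite ?s0 ?t0.
exists V => //.
exists ([set s | s < e], [set t | t < e]) => /=.
  by split; exact: nbhs_right_lt.
by move=> [s t] /= [se te] D.
Qed.

Lemma upper_angle_lt x a b K : (upper_angle L x a b < K%:E)%E ->
  exists2 e, 0 < e & angle_bounded x a b e K.
Proof.
move=> /ereal_inf_lt[_ [V [[P Q] /= [P0 Q0] PQ] <-]] VK.
have [e1 /= e10 Pe] := P0; have [e2 /= e20 Qe] := Q0.
exists (Num.min e1 e2); first by rewrite lt_min e10.
move=> s t /andP[s0 se] /andP[t0 te] D.
rewrite -lee_fin; apply: le_trans (ltW VK); apply: ereal_sup_ubound.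
exists (s, t) => //; apply: (PQ (s, t)) => //; split => /=.
- apply: Pe => //=; rewrite sub0r normrN gtr0_norm//.
  by move: se; rewrite lt_min => /andP[].
- apply: Qe => //=; rewrite sub0r normrN gtr0_norm//.
  by move: te; rewrite lt_min => /andP[].
Qed.

(** A limit superior along an empty domain would be [-oo]; this is excluded by
    exhibiting arbitrarily small admissible parameters. *)
Lemma upper_angle_ge0 x a b :
  (forall e, 0 < e -> exists s t, [/\ 0 < s < e, 0 < t < e,
     angle_domain L x a b (s, t) & 0 <= comparison_angle L x (a s) (b t)]) ->
  (0 <= upper_angle L x a b)%E.
Proof.
move=> H; rewrite leNgt; apply/negP => ltr0.
have [K K0 /upper_angle_lt[e e0 bd]] :
    exists2 K : R, K < 0 & (upper_angle L x a b < K%:E)%E.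
  move: ltr0; case: (upper_angle L x a b) => [r| |] //.
    by rewrite lte_fin => r0; exists (r / 2); rewrite ?lte_fin; lra.
  by exists (-1); rewrite ?ltNyr//; lra.
have [s [t [se te D]]] := H _ e0.
by rewrite leNgt => /negP; apply; apply: le_lt_trans K0; exact: bd.
Qed.

End UpperAngle.

(** * Time reversal *)

Section Opposite.
Context {R : realType} {X : metricType R}.

Definition opposite_causal (C : causal_space X) : causal_space X :=
  @CausalSpace X (fun p q => chron C q p) (fun p q => causal C q p)
    (fun p q r pq qr => chron_trans qr pq)
    (fun p q r pq qr => causal_trans qr pq)
    (causal_refl C) (fun p q pq => chronW pq).

Variable L : lorentzian_prelength X.

Lemma opposite_lsc :
  lower_semicontinuous (fun pq : X * X => tau L pq.2 pq.1).
Proof.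
move=> [p q] a /= apq.
have [V [[P Q] /= [Pq Qp] PQ] aV] := tau_lsc (x := (q, p)) apq.
exists (Q `*` P); first by exists (Q, P).
by move=> [r s] [Qr Ps]; apply: (aV (s, r)); apply: PQ.
Qed.

Lemma opposite_rev_triangle p q r : causal (opposite_causal L) p q ->
  causal (opposite_causal L) q r -> (tau L q p + tau L r q <= tau L r p)%E.
Proof. by move=> pq qr; rewrite addeC; exact: tau_rev_triangle. Qed.

(** The same space with the two causal relations and the arguments of [tau]
    reversed; past directed curves become future directed. *)
Definition opposite : lorentzian_prelength X :=
  @LorentzianPrelength R X (opposite_causal L) (fun p q => tau L q p)
    (fun p q => tau_ge0 L q p) opposite_lsc opposite_rev_triangle
    (fun p q => tau_gt0 L q p).

End Opposite.

Section OppositeAngle.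
Context {R : realType} {X : metricType R}.

Lemma comparison_sideN (L : lorentzian_prelength X) p q p' q' :
  comparison_side L p q p' q' -> comparison_side (opposite L) q p (- q') (- p').
Proof. by rewrite /comparison_side /= mink_causalN mink_tauN. Qed.

(** The central symmetry of the Minkowski plane reverses its causal order. *)
Lemma comparison_triangleN (L : lorentzian_prelength X) x y z x' y' z' :
  comparison_triangle L x y z x' y' z' ->
  comparison_triangle (opposite L) x y z (- x') (- y') (- z').
Proof.
by move=> [[xy yx] [xz zx] [yz zy]]; split; split; exact: comparison_sideN.
Qed.

(** Reversing twice gives back, up to conversion, the same relations. *)
Lemma oppositeK (L : lorentzian_prelength X) x y z x' y' z' :
  comparison_triangle (opposite (opposite L)) x y z x' y' z' ->
  comparison_triangle L x y z x' y' z'.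
Proof. by []. Qed.

Variable L : lorentzian_prelength X.

Lemma comparison_angle_opposite x y z :
  comparison_angle (opposite L) x y z = comparison_angle L x y z.
Proof.
congr (xget 0 _); apply/seteqP; split=> w [x' [y' [z' [H ->]]]];
  exists (- x'), (- y'), (- z'); rewrite !unit_velocityN minkN; split => //.
  exact/oppositeK/comparison_triangleN.
exact: comparison_triangleN.
Qed.

Lemma angle_domain_opposite x a b :
  angle_domain (opposite L) x a b = angle_domain L x a b.
Proof.
apply/seteqP; split=> -[s t] [/= s0 t0 ab [[? ?] [? ?] [? ?]]];
  by split => //; tauto.
Qed.

Lemma upper_angle_opposite x a b :
  upper_angle (opposite L) x a b = upper_angle L x a b.
Proof.
rewrite /upper_angle angle_domain_opposite; congr limf_esup.
by apply/funext => st; rewrite comparison_angle_opposite.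
Qed.

End OppositeAngle.

(** * Germs of timelike curves *)

Section Germs.
Context {R : realType} {X : metricType R} (L : lorentzian_prelength X).

Lemma locally_lipschitz_continuous (I : set R) (c : R -> X) :
  locally_lipschitz I c -> {within I, continuous c}.
Proof.
move=> lip; apply/subspace_continuousP => t It.
have [V Vt [C HC]] := lip _ It.
apply/cvg_ballP => eps eps0.
have C0 : 0 < `|C| + 1 by rewrite ltr_wpDl.
have near_t : \forall s \near t, `|t - s| < eps / (`|C| + 1).
  by apply: nbhsx_ballx; rewrite divr_gt0.
have Vt0 := nbhs_singleton Vt.
rewrite near_withinE; near=> s => Is; rewrite ballEmdist /=.
apply: le_lt_trans (HC _ _ Vt0 _ It Is) _; first by near: s.
apply: (@le_lt_trans _ _ ((`|C| + 1) * `|t - s|)).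
  by rewrite ler_wpM2r// (le_trans (ler_norm C))// lerDl.
by rewrite mulrC -ltr_pdivlMr//; near: s.
Unshelve. all: by end_near. Qed.

Variable U : set X.

Lemma timelike_germ_le x e e' a : e' <= e ->
  timelike_germ L U x e a -> timelike_germ L U x e' a.
Proof.
move=> ee' [ax ca Ua la]; split => //.
- apply: continuous_subspaceW ca => t /=; rewrite !in_itv/= => /andP[-> /=].
  by move=> /le_trans; exact.
- by move=> t /andP[t0 te]; apply: Ua; rewrite t0 (le_trans te).
- by move=> s t s0 st te; apply: la => //; exact: le_trans ee'.
Qed.

Lemma future_timelike_germ x (B : \bar R) a : nbhs x U -> (0 < B)%E ->
  future_timelike L (half_open B) a -> a 0 = x ->
  exists2 e, 0 < e & timelike_germ L U x e a.
Proof.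
move=> Ux B0 [_ lip la] ax.
have [e1 e10 e1B] : exists2 e1 : R, 0 < e1 & (e1%:E < B)%E.
  move: B B0 {lip la} => [r| |] //; rewrite ?lte_fin => r0.
    by exists (r / 2); rewrite ?lte_fin; lra.
  by exists 1; rewrite ?ltry.
have ca := locally_lipschitz_continuous lip.
have I0 : half_open B 0 by split.
have /subspace_continuousP/(_ 0 I0) ca0 := ca.
have : nbhs (a 0) U by rewrite ax.
move=> /ca0 [e2 /= e20 He2].
have sub t : 0 <= t -> t <= Num.min e1 (e2 / 2) -> half_open B t.
  move=> t0; rewrite le_min => /andP[te1 _]; split => //.
  by apply: le_lt_trans e1B; rewrite lee_fin.
exists (Num.min e1 (e2 / 2)); first by rewrite lt_min e10 divr_gt0.
split => //.
- apply: continuous_subspaceW ca => t /=; rewrite in_itv/= => /andP[].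
  exact: sub.
- move=> t /andP[t0 te]; apply: He2; last exact: sub.
  move: te; rewrite le_min => /andP[_ te] /=.
  by rewrite sub0r normrN ger0_norm//; lra.
- move=> s t s0 st te; apply: la => //; apply: sub => //.
    by apply: ltW; apply: lt_le_trans te.
  by apply: ltW; apply: le_lt_trans st.
Qed.

Hypothesis Ufin : forall p q, U p -> U q -> (tau L p q < +oo)%E.
Hypothesis Ucont :
  {within U `*` U, continuous (fun pq : X * X => tau L pq.1 pq.2)}.

(** The chronological past of [p] is open and contains [x]. *)
Lemma germ_eventually_before x e a p : 0 < e ->
  timelike_germ L U x e a -> U p -> chron L x p ->
  exists2 e', 0 < e' & forall s, 0 <= s < e' -> s <= e -> chron L (a s) p.
Proof.
move=> e0 [ax ca Ua la] Up xp.
have Ux : U x by rewrite -ax; apply: Ua; rewrite lexx ltW.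
have cp : {within `[0, e], continuous (fun=> p)}.
  by apply: continuous_subspaceT => ?; exact: cst_continuous.
have Ia t : [set` `[0, e]] t -> U (a t) by rewrite /= in_itv; exact: Ua.
have /subspace_continuousP/(_ 0) := tau_continuous Ufin Ucont ca cp Ia
  (fun=> fun=> Up).
rewrite /= in_itv/= lexx ltW// => /(_ isT) cvg0.
have : 0 < fine (tau L (a 0) p) by rewrite ax; apply/(tr_gt0 Ufin).
move=> /(cvgr_gt _ cvg0) [e' /= e'0 He'].
exists e' => // s /andP[s0 se'] se.
have Us : U (a s) by apply: Ua; rewrite s0.
apply/(tr_gt0 Ufin) => //; apply: He' => /=.
  by rewrite sub0r normrN ger0_norm.
by rewrite in_itv/= s0.
Qed.

Lemma germ_angle_domain x e a b s t : timelike_germ L U x e a ->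
  timelike_germ L U x e b -> 0 < s <= e -> 0 < t <= e ->
  causal L (a s) (b t) \/ causal L (b t) (a s) -> angle_domain L x a b (s, t).
Proof.
move=> [ax _ Ua _] [_ _ Ub _] /andP[s0 se] /andP[t0 te] ab.
have Ux : U x by rewrite -ax; apply: Ua; lra.
have Us : U (a s) by apply: Ua; lra.
have Ut : U (b t) by apply: Ub; lra.
by split => //; split; split; exact: Ufin.
Qed.

Lemma germ_chron x e a s : timelike_germ L U x e a -> 0 < s <= e ->
  chron L x (a s).
Proof. by case=> <- _ _ la /andP[s0 se]; apply: la. Qed.

(** For any [b t] in the future of [x], the points [a s] with small [s] are in
    its past, so admissible pairs exist at every scale. *)
Lemma germ_upper_angle_ge0 x e a b : 0 < e -> timelike_germ L U x e a ->
  timelike_germ L U x e b -> (0 <= upper_angle L x a b)%E.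
Proof.
move=> e0 ga gb; apply: upper_angle_ge0 => r r0.
pose t := Num.min e (r / 2).
have t0 : 0 < t by rewrite lt_min e0 divr_gt0.
have te : t <= e by rewrite ge_min lexx.
have tr2 : t <= r / 2 by rewrite ge_min lexx orbT.
have t0e : 0 < t <= e by rewrite t0.
have [_ _ Ub _] := gb; have Ut : U (b t) by apply: Ub; rewrite ltW.
have [ax _ Ua _] := ga; have Ux : U x by rewrite -ax; apply: Ua; lra.
have [e' e'0 He'] := germ_eventually_before e0 ga Ut (germ_chron gb t0e).
pose s := Num.min t (e' / 2).
have s0 : 0 < s by rewrite lt_min t0 divr_gt0.
have st : s <= t by rewrite ge_min lexx.
have se' : s <= e' / 2 by rewrite ge_min lexx orbT.
have s0e : 0 < s <= e by rewrite s0 (le_trans st).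
have ab : chron L (a s) (b t) by apply: He'; lra.
exists s, t; split; [lra|lra| |].
  by apply: (germ_angle_domain ga gb) => //; left; exact: chronW.
by have [] := comparison_law_of_cosines (germ_chron ga s0e) (germ_chron gb t0e)
  (chronW ab) (Ufin Ux Ut).
Qed.

(** Both orders of [a s] and [c u] occur in the angle domain; the second follows
    from the first by exchanging the outer curves. *)
Lemma germ_upper_angle_triangle x e a b c : 0 < e -> timelike_germ L U x e a ->
  timelike_germ L U x e b -> timelike_germ L U x e c ->
  (upper_angle L x a c <= upper_angle L x a b + upper_angle L x b c)%E.
Proof.
move=> e0 ga gb gc.
have ab0 := germ_upper_angle_ge0 e0 ga gb.
have bc0 := germ_upper_angle_ge0 e0 gb gc.
case E1 : (upper_angle L x a b) ab0 => [A| |] // A0; last first.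
  by rewrite addye ?leey// gt_eqF// (lt_le_trans _ bc0)// ltNyr.
case E2 : (upper_angle L x b c) bc0 => [B| |] // B0; last first.
  by rewrite addey ?leey.
rewrite !lee_fin in A0 B0; apply/lee_addgt0Pr => r r0.
have [e1 e10 H1] : exists2 e1, 0 < e1 & angle_bounded L x a b e1 (A + r / 2).
  by apply: upper_angle_lt; rewrite E1 lte_fin; lra.
have [e2 e20 H2] : exists2 e2, 0 < e2 & angle_bounded L x b c e2 (B + r / 2).
  by apply: upper_angle_lt; rewrite E2 lte_fin; lra.
(* The angle bounds hold strictly below [e1] and [e2], while the intermediate
   curve is used up to and including [e3]; hence the halving. *)
pose e3 := Num.min e (Num.min e1 e2 / 2).
have e30 : 0 < e3 by rewrite lt_min e0 divr_gt0// lt_min e10.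
have e3e : e3 <= e by rewrite ge_min lexx.
have e3E : e3 <= Num.min e1 e2 / 2 by rewrite ge_min lexx orbT.
have m1 : Num.min e1 e2 <= e1 by rewrite ge_min lexx.
have m2 : Num.min e1 e2 <= e2 by rewrite ge_min lexx orbT.
clearbody e3.
have {}ga := timelike_germ_le e3e ga; have {}gb := timelike_germ_le e3e gb.
have {}gc := timelike_germ_le e3e gc.
have [_ _ Ua _] := ga; have [_ _ Ub _] := gb; have [_ _ Uc _] := gc.
have Ube : U (b e3) by apply: Ub; rewrite lexx ltW.
have xbe : chron L x (b e3) by apply: (germ_chron gb); rewrite lexx e30.
have [e4 e40 He4] := germ_eventually_before e30 ga Ube xbe.
have [e5 e50 He5] := germ_eventually_before e30 gc Ube xbe.
apply: (@upper_angle_le _ _ _ _ _ _ (Num.min e3 (Num.min e4 e5))).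
  by rewrite lt_min e30 lt_min e40.
move=> s u; rewrite !lt_min => /andP[s0 /and3P[s3 s4 s5]].
move=> /andP[u0 /and3P[u3 u4 u5]] [_ _ + _] /=.
have s03 : 0 < s <= e3 by rewrite s0 ltW.
have u03 : 0 < u <= e3 by rewrite u0 ltW.
have Us : U (a s) by apply: Ua; lra.
have Uu : U (c u) by apply: Uc; lra.
have sbe : chron L (a s) (b e3) by apply: He4; lra.
have ube : chron L (c u) (b e3) by apply: He5; lra.
have xs := germ_chron ga s03; have xu := germ_chron gc u03.
have Hab t : 0 < t <= e3 -> causal L (a s) (b t) \/ causal L (b t) (a s) ->
    comparison_angle L x (a s) (b t) <= A + r / 2.
  move=> t03 ab; apply: H1; [lra|lra|].
  exact: (germ_angle_domain ga gb).
have Hbc t : 0 < t <= e3 -> causal L (b t) (c u) \/ causal L (c u) (b t) ->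
    comparison_angle L x (b t) (c u) <= B + r / 2.
  move=> t03 bc; apply: H2; [lra|lra|].
  exact: (germ_angle_domain gb gc).
have -> : A + B + r = (A + r / 2) + (B + r / 2) by lra.
case=> [su|us].
  apply: (hinge_angle_le Ufin Ucont e30 gb) => //; rewrite ?addr_ge0//; try lra.
    by move=> t t03 st; apply: Hab => //; left.
  by move=> t t03 tu; apply: Hbc => //; left.
rewrite comparison_angleC addrC.
apply: (hinge_angle_le Ufin Ucont e30 gb) => //; rewrite ?addr_ge0//; try lra.
  by move=> t t03 ut; rewrite comparison_angleC; apply: Hbc => //; right.
by move=> t t03 ts; rewrite comparison_angleC; apply: Hab => //; right.
Qed.

End Germs.

Section Future.
Context {R : realType} {X : metricType R} (L : lorentzian_prelength X).

Lemma future_upper_angle_triangle (B : \bar R) (U : set X) x a b c :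
  nbhs x U -> (forall p q, U p -> U q -> (tau L p q < +oo)%E) ->
  {within U `*` U, continuous (fun pq : X * X => tau L pq.1 pq.2)} ->
  (0 < B)%E -> future_timelike L (half_open B) a ->
  future_timelike L (half_open B) b -> future_timelike L (half_open B) c ->
  a 0 = x -> b 0 = x -> c 0 = x ->
  (upper_angle L x a c <= upper_angle L x a b + upper_angle L x b c)%E.
Proof.
move=> Ux Ufin Ucont B0 fa fb fc ax bx cx.
have [e1 e10 g1] := future_timelike_germ Ux B0 fa ax.
have [e2 e20 g2] := future_timelike_germ Ux B0 fb bx.
have [e3 e30 g3] := future_timelike_germ Ux B0 fc cx.
pose e := Num.min e1 (Num.min e2 e3).
have e0 : 0 < e by rewrite !lt_min e10 e20.
apply: (germ_upper_angle_triangle Ufin Ucont e0).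
- by apply: timelike_germ_le g1; rewrite ge_min lexx.
- by apply: timelike_germ_le g2; rewrite !ge_min lexx orbT.
- by apply: timelike_germ_le g3; rewrite !ge_min lexx !orbT.
Qed.

End Future.

Lemma opposite_continuous (R : realType) (X : metricType R)
    (L : lorentzian_prelength X) (U : set X) :
  {within U `*` U, continuous (fun pq : X * X => tau L pq.1 pq.2)} ->
  {within U `*` U, continuous (fun pq : X * X => tau (opposite L) pq.1 pq.2)}.
Proof.
move=> /subspace_continuousP cL; apply/subspace_continuousP => -[p q] [Up Uq].
have c0 := cL (q, p) (conj Uq Up).
apply: (@cvg_comp _ _ _ (fun pq : X * X => (pq.2, pq.1)) _ _ _ _ _ c0) => A.
move=> [[P Q] /= [Pq Qp] PQ].
exists (Q, P) => // -[r s] [/= Qr Ps] [/= Ur Us].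
by apply: (PQ (s, r)).
Qed.

Theorem theorem3p1 (R : realType) (X : metricType R)
    (L : lorentzian_prelength X) (B : \bar R) (alpha beta gamma : R -> X)
    (x : X) :
  strongly_causal L ->
  locally_causally_closed L ->
  locally_finite_valued L ->
  locally_continuous L ->
  (0 < B)%E ->
  [/\ future_timelike L (half_open B) alpha,
      future_timelike L (half_open B) beta &
      future_timelike L (half_open B) gamma] \/
  [/\ past_timelike L (half_open B) alpha,
      past_timelike L (half_open B) beta &
      past_timelike L (half_open B) gamma] ->
  alpha 0 = x -> beta 0 = x -> gamma 0 = x ->
  (upper_angle L x alpha gamma <=
     upper_angle L x alpha beta + upper_angle L x beta gamma)%E.
Proof.
move=> _ _ fin_tau cont_tau B0 dir ax bx cx.
have [U1 U1x fin1] := fin_tau x; have [U2 U2x cont2] := cont_tau x.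
pose U := U1 `&` U2.
have Ux : nbhs x U by exact: filterI.
have Ufin p q : U p -> U q -> (tau L p q < +oo)%E.
  by move=> [U1p _] [U1q _]; exact: fin1.
have Ucont : {within U `*` U, continuous (fun pq : X * X => tau L pq.1 pq.2)}.
  by apply: continuous_subspaceW cont2 => -[p q] [[_ ?] [_ ?]].
case: dir => [] [fa fb fc].
  exact: (future_upper_angle_triangle Ux Ufin Ucont B0 fa fb fc).
rewrite -!(upper_angle_opposite L).
apply: (@future_upper_angle_triangle _ _ (opposite L) B U) => //.
  by move=> p q Up Uq; exact: Ufin.
exact: opposite_continuous.
Qed.
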